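(* Let $n\ge8$ be a multiple of $4$. (i) Every nonempty shell of $W_n$ and of $\mathrm{Sh}(W_n)$ is a spherical $3$-design. (ii) Every nonempty shell of $W_8$ is a spherical $7$-design. (iii) Every nonempty shell of $W_{16}$ is a spherical $3\tfrac12$-design.
   Context: For $n$ a positive multiple of $4$, $W_n=\{x\in\mathbb R^n: 2x_i\in\mathbb Z,\ x_i-x_1\in\mathbb Z\ \forall i,\ \sum_ix_i\in2\mathbb Z\}$; it is selfdual, even if $n\equiv0\pmod8$ and odd otherwise. Its shadow is $\mathrm{Sh}(W_n)=W_n$ if $n\equiv 0\pmod 8$, and for $n\equiv4\pmod8$, $\mathrm{Sh}(W_n)=\{x: 2x_i\in\mathbb Z,\ x_i-x_1\in\mathbb Z\ \forall i,\ \sum_ix_i\in2\mathbb Z+1\}$. Shell of norm $m$: $A_m=\{x\in A:\langle x,x\rangle=m\}$. Designs (antipodal sets): $(C_{2j})$ means $\sum_{x\in X}P(x)=0$ for every homogeneous harmonic polynomial $P$ of degree $2j$; $X$ is a spherical $t$-design iff $(C_{2j})$ holds for all $2\le2j\le t$; a spherical $(2s+1+\tfrac12)$-design satisfies $(C_{2j})$ for $2\le2j\le2s$ and for $2j=2s+4$ (so a $3\tfrac12$-design satisfies $(C_2)$ and $(C_6)$). *)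

(* Defs.v *)
From HB Require Import structures.
From mathcomp Require Import all_boot all_order all_algebra.
From mathcomp Require Import reals.
From mathcomp Require Import mpoly.
Set Implicit Arguments. Unset Strict Implicit. Unset Printing Implicit Defensive.
Import Order.TTheory GRing.Theory Num.Theory.
Local Open Scope ring_scope.

Section W.
Variable R : realType.

Definition coord n (x : 'rV[R]_n) (i : 'I_n) : R := x ord0 i.

Definition dotp n (x y : 'rV[R]_n) : R := \sum_(i < n) coord x i * coord y i.

Definition W_lattice n (x : 'rV[R]_n) : Prop :=
  (forall i : 'I_n, 2 * coord x i \is a Num.int) /\
  (forall (h : (0 < n)%N) (i : 'I_n), coord x i - coord x (Ordinal h) \is a Num.int) /\
  ((\sum_(i < n) coord x i) / 2 \is a Num.int).

(* Shadow of W_n (n a multiple of 4):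
   W_n if n = 0 mod 8, and
   { x : 2x_i in Z, x_i - x_1 in Z for all i, sum_i x_i in 2Z+1 } if n = 4 mod 8. *)
Definition W_shadow n (x : 'rV[R]_n) : Prop :=
  if (8 %| n)%N then W_lattice x
  else
  (forall i : 'I_n, 2 * coord x i \is a Num.int) /\
  (forall (h : (0 < n)%N) (i : 'I_n), coord x i - coord x (Ordinal h) \is a Num.int) /\
  (((\sum_(i < n) coord x i) - 1) / 2 \is a Num.int).

Definition shell n (A : 'rV[R]_n -> Prop) (m : R) (x : 'rV[R]_n) : Prop :=
  A x /\ dotp x x = m.

Definition laplacian n (P : {mpoly R[n]}) : {mpoly R[n]} :=
  \sum_(i < n) mderiv i (mderiv i P).

Definition harmonic_homog n (k : nat) (P : {mpoly R[n]}) : Prop :=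
  P \is k.-homog /\ laplacian P = 0.

Definition enumerates n (s : seq 'rV[R]_n) (X : 'rV[R]_n -> Prop) : Prop :=
  uniq s /\ forall x, x \in s <-> X x.

Definition cond_C n (k : nat) (X : 'rV[R]_n -> Prop) : Prop :=
  exists s : seq 'rV[R]_n, enumerates s X /\
    forall P : {mpoly R[n]}, harmonic_homog k P ->
      \sum_(x <- s) P.@[coord x] = 0.

(* spherical t-design (antipodal sets): (C_2j) for all 2 <= 2j <= t *)
Definition design n (t : nat) (X : 'rV[R]_n -> Prop) : Prop :=
  forall j : nat, (2 <= 2 * j <= t)%N -> cond_C (2 * j) X.

(* spherical (2s+1+1/2)-design: (C_2j) for 2 <= 2j <= 2s and for 2j = 2s+4 *)
Definition half_design n (s : nat) (X : 'rV[R]_n -> Prop) : Prop :=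
  (forall j : nat, (2 <= 2 * j <= 2 * s)%N -> cond_C (2 * j) X) /\
  cond_C (2 * s + 4) X.

Definition nonempty n (X : 'rV[R]_n -> Prop) : Prop := exists x, X x.

End W.

(* Main.v *)
Require Import Defs.
From HB Require Import structures.
From mathcomp Require Import all_boot all_order all_algebra.
From mathcomp Require Import reals.
From mathcomp Require Import mpoly.
From mathcomp Require Import perm zify ring lra.
Import Order.TTheory GRing.Theory Num.Theory.
Local Open Scope ring_scope.

(* All the shells in question are invariant under permutations and even sign
   changes of the coordinates, so the sum of a harmonic polynomial of degree
   2k < n over a shell only depends on the moments of even monomials: degree 2
   is automatic, degree 4 amounts to S4 = 3 S22 and degree 6 to
   S6 - 15 S42 + 30 S222 = 0.

   W_8 is moreover invariant under the half Hadamard matrix acting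
   simultaneously on the two blocks of four coordinates; applied to x1^4, x1^6
   and x1^4 x5^2 this invariance yields both relations.

   For W_16 = D16+ no symmetry suffices, and modular forms are replaced by
   triality. D16+ and E8 + E8 are both glued from four copies of D4, and their
   glue codes agree, word by word and up to permuting the last three copies,
   once the three nontrivial classes of D4*/D4 are identified. Triality
   identifies these classes isometrically and fixes the harmonic sextic of the
   Weyl group of F4, so the sums of that sextic of the first block over the
   shells of D16+ and of E8 + E8 coincide. On E8 + E8 the sum vanishes by the
   invariance used for W_8, and on D16+ it is a multiple of
   S6 - 15 S42 + 30 S222. *)

Set Implicit Arguments.
Unset Strict Implicit.

(** * Harmonic sums and even moments *)

(* By homogeneity the hypothesis says that, on degree [k], the sum over [t] is
   [J] composed with the Laplacian. *)
Lemma harmonic_sum0 (R : realType) n k (t : seq 'rV[R]_n)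
    (J : 'X_{1..n} -> R) :
  (forall m : 'X_{1..n}, mdeg m = k ->
     \sum_(x <- t) \prod_i x 0 i ^+ m i =
     \sum_i (m i * (m i).-1)%:R * J (m - U_(i) - U_(i))%MM) ->
  forall P : {mpoly R[n]}, harmonic_homog k P ->
    \sum_(x <- t) P.@[Defs.coord x] = 0.
Proof.
move=> momE P [/dhomogP Phom lapP].
(* [JJ] extends [J] linearly to polynomials; bounding degrees by [k] makes the sum range over a
   finite type. *)
pose JJ (Q : {mpoly R[n]}) : R := \sum_(m : 'X_{1..n < k.+1}) Q@_m * J m.
have JJX (m : 'X_{1..n}) : (mdeg m < k.+1)%N -> JJ 'X_[m] = J m.
  move=> ltm; rewrite /JJ (bigD1 (BMultinom ltm)) //= mcoeffX eqxx mul1r.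
  rewrite big1 ?addr0 // => m' ne; rewrite mcoeffX.
  case: eqP => [e|]; last by rewrite mul0r.
  by case/eqP: ne; apply/val_inj; rewrite /= e.
have JJD Q Q' : JJ (Q + Q') = JJ Q + JJ Q'.
  by rewrite /JJ -big_split; apply/eq_bigr => m _; rewrite mcoeffD mulrDl.
have JJZ c Q : JJ (c *: Q) = c * JJ Q.
  by rewrite /JJ mulr_sumr; apply/eq_bigr => m _; rewrite mcoeffZ mulrA.
have JJ0 : JJ 0 = 0 by rewrite /JJ big1 // => m _; rewrite mcoeff0 mul0r.
have lapE : laplacian P = \sum_(m <- msupp P) P@_m *:
    \sum_i (m i * (m i).-1)%:R *: 'X_[(m - U_(i) - U_(i))].
  have dE i (r : seq 'X_{1..n}) (F : 'X_{1..n} -> {mpoly R[n]}) :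
    mderiv i (\sum_(m <- r) F m) = \sum_(m <- r) mderiv i (F m).
    by apply: big_morph; [exact: mderivD | exact: mderiv0].
  under [RHS]eq_bigr do rewrite scaler_sumr.
  rewrite [RHS]exchange_big /laplacian; apply: eq_bigr => i _.
  rewrite {1}(mpolyE P) (dE i _ (fun m => P@_m *: 'X_[m])).
  rewrite (dE i _ (fun m => mderiv i (P@_m *: 'X_[m]))).
  apply: eq_bigr => m _.
  by rewrite !(mderivZ, mderivX) !scalerA natrM mnmBE mnm1E eqxx subn1 mulrA.
under eq_bigr do rewrite mevalE.
rewrite exchange_big /=; transitivity (JJ (laplacian P)); last by rewrite lapP JJ0.
rewrite lapE (big_morph JJ JJD JJ0).
apply: eq_big_seq => m /Phom dm; rewrite JJZ -mulr_sumr momE //; congr (_ * _).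
rewrite (big_morph JJ JJD JJ0); apply: eq_bigr => i _; rewrite JJZ JJX //.
by rewrite ltnS -dm (leq_trans (mdegB _ _)) // mdegB.
Qed.

(** * Invariance under the Weyl group of D_n *)

Definition flip2 (R : zmodType) n (i j : 'I_n) (x : 'rV[R]_n) : 'rV[R]_n :=
  \row_k (if (k == i) || (k == j) then - x 0 k else x 0 k).

(** Transpositions and double sign changes generate the Weyl group of D_n. Multiplicities count,
    because a list with repetitions occurs later for E8 + E8. *)
Definition D_invariant (R : zmodType) n (t : seq 'rV[R]_n) : Prop :=
  (forall i j, perm_eq (map (xcol i j) t) t) /\
  (forall i j, i != j -> perm_eq (map (flip2 i j) t) t).

Lemma sum_invariant (R : nmodType) (T : eqType) (g : T -> T) (t : seq T)
    (F : T -> R) :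
  perm_eq (map g t) t -> \sum_(x <- t) F (g x) = \sum_(x <- t) F x.
Proof. by move=> gt; rewrite -[LHS](big_map g predT F) (perm_big _ gt). Qed.

Section TpermInvariant.
Variables (n : nat) (A : Type) (F : 'I_n -> 'I_n -> 'I_n -> A).
Hypothesis F_tperm : forall a b i j k,
  F i j k = F (tperm a b i) (tperm a b j) (tperm a b k).

Lemma tperm_invariant1 i i' : F i i i = F i' i' i'.
Proof. by rewrite (F_tperm i i') !tpermL. Qed.

Lemma tperm_invariant2 i j i' j' : i != j -> i' != j' -> F i i j = F i' i' j'.
Proof.
move=> ij ij'; rewrite (F_tperm i i') !tpermL.
set j1 := tperm i i' j.
have ij1 : i' != j1 by rewrite -(tpermL i i') (inj_eq perm_inj).
by rewrite (F_tperm j1 j') tpermL tpermD // eq_sym.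
Qed.

(** The indices are moved to their targets one at a time; each later transposition exchanges two
    indices different from the targets already reached. *)
Lemma tperm_invariant3 i j k i' j' k' : uniq [:: i; j; k] ->
  uniq [:: i'; j'; k'] -> F i j k = F i' j' k'.
Proof.
rewrite /= !inE !negb_or !andbT => /andP[/andP[ij ik] jk].
move=> /andP[/andP[ij' ik'] jk']; rewrite (F_tperm i i') !tpermL.
set j1 := tperm i i' j; set k1 := tperm i i' k.
have ij1 : i' != j1 by rewrite -(tpermL i i') (inj_eq perm_inj).
have ik1 : i' != k1 by rewrite -(tpermL i i') (inj_eq perm_inj).
have jk1 : j1 != k1 by rewrite (inj_eq perm_inj).
rewrite (F_tperm j1 j') tpermL (tpermD (z := i')) 1?eq_sym //.
set k2 := tperm j1 j' k1.
have ik2 : i' != k2.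
  have <- : tperm j1 j' i' = i' by rewrite tpermD 1?eq_sym.
  by rewrite (inj_eq perm_inj).
have jk2 : j' != k2 by rewrite -(tpermL j1 j') (inj_eq perm_inj).
by rewrite (F_tperm k2 k') tpermL !tpermD // eq_sym.
Qed.

End TpermInvariant.

(** A nonzero even exponent is at least 2, so the square of a variable splits off; iterating lists
    the even monomials of degrees 2, 4 and 6. *)
Lemma mnm_even_peel n (m : 'X_{1..n}) d : (forall i, ~~ odd (m i)) ->
  mdeg m = d.+2 -> exists i (m' : 'X_{1..n}),
    [/\ m = (m' + (U_(i) + U_(i)))%MM, forall j, ~~ odd (m' j) & mdeg m' = d].
Proof.
move=> ev dm; have [i mi] : exists i, m i != 0%N.
  apply/existsP; apply: contra_eqT dm; rewrite negb_exists => /forallP m0.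
  by rewrite mdegE big1 // => i _; apply/eqP; rewrite -[_ == _]negbK.
have mi2 : (1 < m i)%N by move: (ev i) mi; case: (m i) => [|[]].
exists i, (m - (U_(i) + U_(i)))%MM.
have e : m = (m - (U_(i) + U_(i)) + (U_(i) + U_(i)))%MM.
  by apply/mnmP => j; rewrite !mnmE; case: eqP => [<-|_] //=; lia.
split=> // [j|].
  rewrite !mnmE; case: eqP => [<-|_] /=; last by rewrite subn0.
  by rewrite oddB // (negbTE (ev i)).
by move: dm; rewrite {1}e !mdegD !mdeg1; lia.
Qed.

Lemma mnm_even2 n (m : 'X_{1..n}) : (forall i, ~~ odd (m i)) -> mdeg m = 2 ->
  exists i, m = (U_(i) + U_(i))%MM.
Proof.
move=> ev /(mnm_even_peel ev)[i [m' [-> _ /eqP]]].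
by rewrite mdeg_eq0 => /eqP->; exists i; rewrite add0m.
Qed.

Lemma mnm_even4 n (m : 'X_{1..n}) : (forall i, ~~ odd (m i)) -> mdeg m = 4 ->
  exists i j, m = (U_(i) + U_(i) + (U_(j) + U_(j)))%MM.
Proof.
move=> ev /(mnm_even_peel ev)[j [m' [-> ev' /(mnm_even2 ev')[i ->]]]].
by exists i, j.
Qed.

Lemma mnm_even6 n (m : 'X_{1..n}) : (forall i, ~~ odd (m i)) -> mdeg m = 6 ->
  exists i j k,
    m = (U_(i) + U_(i) + (U_(j) + U_(j)) + (U_(k) + U_(k)))%MM.
Proof.
move=> ev /(mnm_even_peel ev)[k [m' [-> ev' /(mnm_even4 ev')[i [j ->]]]]].
by exists i, j, k.
Qed.

Section Moments.
Variables (R : realType) (n : nat) (t : seq 'rV[R]_n).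
Hypothesis t_inv : D_invariant t.

Definition moment (m : 'X_{1..n}) : R := \sum_(x <- t) \prod_i x 0 i ^+ m i.

(** Degree below [n] leaves some variable [j] out of the monomial, so changing the signs of
    coordinates [i] and [j] just negates the monomial. *)
Lemma moment_odd (m : 'X_{1..n}) i : odd (m i) -> (mdeg m < n)%N -> moment m = 0.
Proof.
move=> odd_mi dm; have [j mj] : exists j, m j == 0%N.
  apply/existsP; apply: contraTT dm; rewrite negb_exists -leqNgt => /forallP m0.
  rewrite mdegE -[X in (X <= _)%N]card_ord -sum1_card; apply: leq_sum => j _.
  by rewrite lt0n.
have ij : i != j by apply: contraTneq odd_mi => ->; rewrite (eqP mj).
suff : moment m = - moment m by lra.
rewrite {1}/moment -(sum_invariant _ (t_inv.2 i j ij)) -sumrN.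
apply: eq_bigr => x _; rewrite [in LHS](bigD1 i) //= [in RHS](bigD1 i) //=.
rewrite mxE eqxx /= exprNn -signr_odd odd_mi expr1 mulN1r mulNr; congr (- (_ * _)).
apply: eq_bigr => k ki; rewrite mxE (negbTE ki) /=.
by case: eqP => // ->; rewrite (eqP mj) !expr0.
Qed.

Lemma prod_mnmD (x : 'rV[R]_n) (m m' : 'X_{1..n}) :
  \prod_i x 0 i ^+ (m + m')%MM i = \prod_i x 0 i ^+ m i * \prod_i x 0 i ^+ m' i.
Proof. by rewrite -big_split; apply: eq_bigr => i _; rewrite mnmDE exprD. Qed.

Lemma prod_mnm1 (x : 'rV[R]_n) i : \prod_j x 0 j ^+ U_(i)%MM j = x 0 i.
Proof.
rewrite (bigD1 i) //= mnm1E eqxx expr1 big1 ?mulr1 // => j ji.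
by rewrite mnm1E eq_sym (negbTE ji).
Qed.

(** Moments with an odd exponent vanish. Setting [J] to 0 on monomials with an odd exponent is
    consistent with this, since the Laplacian preserves the parities of exponents. *)
Lemma harmonic_sum0_even k (J : 'X_{1..n} -> R) : (k < n)%N ->
  (forall m : 'X_{1..n}, mdeg m = k -> (forall i, ~~ odd (m i)) ->
     moment m = \sum_i (m i * (m i).-1)%:R * J (m - U_(i) - U_(i))%MM) ->
  forall P : {mpoly R[n]}, harmonic_homog k P ->
    \sum_(x <- t) P.@[Defs.coord x] = 0.
Proof.
move=> kn ev_mom.
pose J' (m : 'X_{1..n}) := if [forall i, ~~ odd (m i)] then J m else 0.
apply: (@harmonic_sum0 _ _ _ _ J') => m dm.
have [/forallP ev|] := boolP [forall i, ~~ odd (m i)].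
  rewrite [LHS](ev_mom _ dm ev); apply: eq_bigr => i _.
  have [mi|mi] := boolP (m i == 0%N); first by rewrite (eqP mi) !mul0r.
  rewrite /J' ifT //; apply/forallP => j; rewrite !mnmE -subnDA addnn.
  rewrite oddB ?odd_double ?(negbTE (ev j)) // -addnn.
  by case: eqP => [<-|_] //=; move: (ev i) mi; case: (m i) => [|[]].
rewrite negb_forall => /existsP[i]; rewrite negbK => oi.
rewrite [LHS](@moment_odd _ i) ?dm // big1 // => j _.
(* Truncated subtraction could spoil the parity only at exponent 1, where the factor
   [m j * (m j).-1] vanishes. *)
have [mj|mj] := leqP (m j) 1%N.
  suff -> : (m j * (m j).-1 = 0)%N by rewrite mul0r.
  by case: (m j) mj => [|[]].
rewrite /J' ifF ?mulr0 //; apply/negbTE; rewrite negb_forall.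
apply/existsP; exists i; rewrite negbK !mnmE -subnDA addnn.
rewrite oddB ?odd_double ?addbF // -addnn.
by case: eqP mj => [->|_] //=.
Qed.

(** Indices may repeat: S6, S42 and S222 are the values at [i i i], [i i j] and [i j k]. *)
Definition qmoment i j k : R :=
  \sum_(x <- t) x 0 i ^+ 2 * x 0 j ^+ 2 * x 0 k ^+ 2.

Lemma sum_tperm a b (F : 'rV[R]_n -> R) :
  \sum_(x <- t) F (\row_k x 0 (tperm a b k)) = \sum_(x <- t) F x.
Proof.
rewrite -(sum_invariant F (t_inv.1 a b)); apply: eq_bigr => x _.
by congr F; apply/rowP => k; rewrite !mxE.
Qed.

Lemma qmoment_tperm a b i j k : qmoment i j k =
  qmoment (tperm a b i) (tperm a b j) (tperm a b k).
Proof.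
by rewrite {1}/qmoment -(sum_tperm a b); apply: eq_bigr => x _; rewrite !mxE.
Qed.

Lemma harmonic2_sum0 : (2 < n)%N -> forall P : {mpoly R[n]},
  harmonic_homog 2 P -> \sum_(x <- t) P.@[Defs.coord x] = 0.
Proof.
move=> n2; pose i0 := Ordinal (ltnW n2).
pose S i := \sum_(x <- t) x 0 i ^+ 2.
have Sc i j : S i = S j.
  apply: (@tperm_invariant1 n R (fun i _ _ => S i)) => a b k _ _.
  by rewrite {1}/S -(sum_tperm a b); apply: eq_bigr => x _; rewrite mxE.
(* The Laplacian of x_i^2 is 2, whence the value S / 2 on the constant monomial. *)
apply: (@harmonic_sum0_even 2 (fun=> S i0 / 2) n2) => m dm ev.
have [i ->] := mnm_even2 ev dm.
rewrite (bigD1 i) //= !mnmE eqxx /= big1 => [|j ji]; last first.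
  by rewrite !mnmE eq_sym (negbTE ji) mul0r.
have -> : moment (U_(i) + U_(i)) = S i.
  by apply: eq_bigr => x _; rewrite prod_mnmD !prod_mnm1.
by rewrite (Sc i i0) /=; field.
Qed.

(** The Laplacian sends x^4 to 12 x^2 and x^2 y^2 to 2 x^2 + 2 y^2. The value S22 / 4 on every
    square therefore produces 3 S22 and S22, which are the moments when S4 = 3 S22. *)
Lemma harmonic4_sum0 i0 j0 : (4 < n)%N -> i0 != j0 ->
  \sum_(x <- t) x 0 i0 ^+ 4 = 3 * \sum_(x <- t) x 0 i0 ^+ 2 * x 0 j0 ^+ 2 ->
  forall P : {mpoly R[n]}, harmonic_homog 4 P ->
    \sum_(x <- t) P.@[Defs.coord x] = 0.
Proof.
move=> n4 ij0 rel.
pose S i j := \sum_(x <- t) x 0 i ^+ 2 * x 0 j ^+ 2.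
have S_tperm a b i j k : (fun i _ j => S i j) i j k =
   (fun i _ j => S i j) (tperm a b i) (tperm a b j) (tperm a b k).
  by rewrite /= {1}/S -(sum_tperm a b); apply: eq_bigr => x _; rewrite !mxE.
have relS : S i0 i0 = 3 * S i0 j0.
  by rewrite -rel; apply: eq_bigr => x _; rewrite -exprD.
apply: (@harmonic_sum0_even 4 (fun=> S i0 j0 / 4) n4) => m dm ev.
have [i [j ->]] := mnm_even4 ev dm.
have -> : moment (U_(i) + U_(i) + (U_(j) + U_(j))) = S i j.
  by apply: eq_bigr => x _; rewrite !prod_mnmD !prod_mnm1.
have [<-|ij] := eqVneq i j.
  rewrite (bigD1 i) //= !mnmE eqxx /= big1 => [|k ki]; last first.
    by rewrite !mnmE eq_sym (negbTE ki) mul0r.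
  by rewrite (tperm_invariant1 S_tperm i i0) relS /=; field.
rewrite (bigD1 i) //= (bigD1 j) 1?eq_sym //=.
rewrite !mnmE !eqxx (negbTE ij) eq_sym (negbTE ij) /=.
rewrite big1 => [|k /andP[ki kj]]; last first.
  by rewrite !mnmE eq_sym (negbTE ki) eq_sym (negbTE kj) mul0r.
by rewrite (tperm_invariant2 S_tperm ij ij0) //=; field.
Qed.

(** The Laplacian sends x^6 to 30 x^4 and x^2 y^2 z^2 to twice the sum of the three products, which
    forces the values S6 / 30 and S222 / 6. As x^4 y^2 goes to 12 x^2 y^2 + 2 x^4, the remaining
    condition is S42 = 2 S222 + S6 / 15. *)
Lemma harmonic6_sum0 i0 j0 k0 : (6 < n)%N -> uniq [:: i0; j0; k0] ->
  qmoment i0 i0 i0 - 15 * qmoment i0 i0 j0 + 30 * qmoment i0 j0 k0 = 0 ->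
  forall P : {mpoly R[n]}, harmonic_homog 6 P ->
    \sum_(x <- t) P.@[Defs.coord x] = 0.
Proof.
move=> n6 u0 rel.
have ij0 : i0 != j0 by move: u0; rewrite /= !inE negb_or => /andP[/andP[]].
(* The two values of a symmetric functional on the monomials x^4 and x^2 y^2
   whose composition with the Laplacian has the given moments. *)
pose J (m : 'X_{1..n}) :=
  if [exists i, m i == 4%N] then qmoment i0 i0 i0 / 30 else qmoment i0 j0 k0 / 6.
have J4 i : J (U_(i) + U_(i) + (U_(i) + U_(i)))%MM = qmoment i0 i0 i0 / 30.
  by rewrite /J ifT //; apply/existsP; exists i; rewrite !mnmE eqxx.
have J22 i j : i != j ->
    J (U_(i) + U_(i) + (U_(j) + U_(j)))%MM = qmoment i0 j0 k0 / 6.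
  move=> ij; rewrite /J ifF //; apply/existsP => -[k]; rewrite !mnmE.
  case: (i =P k) => [<-|_]; first by rewrite (eq_sym j) (negbTE ij).
  by case: (j =P k).
have momE i j k : moment (U_(i) + U_(i) + (U_(j) + U_(j)) + (U_(k) + U_(k)))%MM =
    qmoment i j k.
  by apply: eq_bigr => x _; rewrite !prod_mnmD !prod_mnm1.
(* The type x^4 y^2 is where the relation between the moments enters; three coincidence patterns of
   the indices reduce to it. *)
have two i k : i != k ->
   let m := (U_(i) + U_(i) + (U_(i) + U_(i)) + (U_(k) + U_(k)))%MM in
   moment m = \sum_l (m l * (m l).-1)%:R * J (m - U_(l) - U_(l))%MM.
  move=> ik m; rewrite (bigD1 i) //= (bigD1 k) 1?eq_sym //=.
  have -> : (m - U_(i) - U_(i) = U_(i) + U_(i) + (U_(k) + U_(k)))%MM.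
    by apply/mnmP => l; rewrite !mnmE; lia.
  have -> : (m - U_(k) - U_(k) = U_(i) + U_(i) + (U_(i) + U_(i)))%MM.
    by apply/mnmP => l; rewrite !mnmE; lia.
  rewrite J4 J22 // !mnmE !eqxx (negbTE ik) eq_sym (negbTE ik) /=.
  rewrite big1 => [|l /andP[li lk]]; last first.
    by rewrite !mnmE eq_sym (negbTE li) eq_sym (negbTE lk) mul0r.
  rewrite momE (tperm_invariant2 qmoment_tperm ik ij0) //.
  have -> : qmoment i0 i0 j0 = (qmoment i0 i0 i0 + 30 * qmoment i0 j0 k0) / 15.
    by lra.
  by field.
apply: (@harmonic_sum0_even 6 J n6) => m dm ev.
have [i [j [k ->]]] := mnm_even6 ev dm.
have [<-|ij] := eqVneq i j.
  have [<-|ik] := eqVneq i k; last exact: two.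
  set m' := (_ + _)%MM; rewrite (bigD1 i) //=.
  have -> : (m' - U_(i) - U_(i) = U_(i) + U_(i) + (U_(i) + U_(i)))%MM.
    by apply/mnmP => l; rewrite !mnmE; lia.
  rewrite momE J4 (tperm_invariant1 qmoment_tperm i i0) !mnmE eqxx /=.
  rewrite big1 => [|l li]; last by rewrite !mnmE eq_sym (negbTE li) mul0r.
  by field.
have [<-|ik] := eqVneq i k.
  by rewrite -addmA (addmC (U_(j) + U_(j))%MM) addmA; apply: two.
have [<-|jk] := eqVneq j k.
  by rewrite -addmA addmC; apply: two; rewrite eq_sym.
rewrite momE; set m' := (_ + _)%MM.
rewrite (bigD1 i) //= (bigD1 j) 1?eq_sym //= (bigD1 k) ?(eq_sym k) ?ik //=.
have -> : (m' - U_(i) - U_(i) = U_(j) + U_(j) + (U_(k) + U_(k)))%MM.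
  by apply/mnmP => l; rewrite !mnmE; lia.
have -> : (m' - U_(j) - U_(j) = U_(i) + U_(i) + (U_(k) + U_(k)))%MM.
  by apply/mnmP => l; rewrite !mnmE; lia.
have -> : (m' - U_(k) - U_(k) = U_(i) + U_(i) + (U_(j) + U_(j)))%MM.
  by apply/mnmP => l; rewrite !mnmE; lia.
rewrite !J22 // !mnmE !eqxx ?(eq_sym k) ?(eq_sym j i).
rewrite (negbTE ij) (negbTE ik) (negbTE jk) /=.
rewrite big1 => [|l /andP[/andP[li lj] lk]]; last first.
  by rewrite !mnmE !(eq_sym _ l) (negbTE li) (negbTE lj) (negbTE lk) mul0r.
have u : uniq [:: i; j; k] by rewrite /= !inE negb_or ij ik jk.
by rewrite (tperm_invariant3 qmoment_tperm u u0); field.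
Qed.

End Moments.

(** * Moments of E8-invariant multisets *)

Local Notation o8 k := (@Ordinal 8 k isT).

Section E8Moments.
Variables (R : realType) (t : seq 'rV[R]_8).
Hypothesis t_inv : D_invariant t.

Let Sum5 (f : R -> R -> R -> R -> R -> R) := \sum_(x <- t)
  f (x 0 (o8 0)) (x 0 (o8 1)) (x 0 (o8 2)) (x 0 (o8 3)) (x 0 (o8 4)).

Let sum5_ext f f' : (forall a b c d e, f a b c d e = f' a b c d e) ->
  Sum5 f = Sum5 f'.
Proof. by move=> ff'; apply: eq_bigr. Qed.

(* Coordinate 7 is free to absorb the second sign of an even sign change. *)
Let sum5_sign f :
  [/\ Sum5 (fun a b c d e => f a (- b) c d e) = Sum5 f,
      Sum5 (fun a b c d e => f a b (- c) d e) = Sum5 f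
    & Sum5 (fun a b c d e => f a b c (- d) e) = Sum5 f].
Proof.
by split; rewrite /Sum5;
  [have := t_inv.2 (o8 1) (o8 7) isT | have := t_inv.2 (o8 2) (o8 7) isT
  | have := t_inv.2 (o8 3) (o8 7) isT];
  move=> /(@sum_invariant R _ _ _ (fun x : 'rV[R]_8 =>
    f (x 0 (o8 0)) (x 0 (o8 1)) (x 0 (o8 2)) (x 0 (o8 3)) (x 0 (o8 4)))) <-;
  apply: eq_bigr => x _; rewrite !mxE.
Qed.

(** Averaging over the signs of [b], [c], [d] removes their odd powers, and with them the odd powers
    of [a] in a form of even degree in [a], [b], [c], [d]. *)
Let sum5_average f : 8 * Sum5 f = Sum5 (fun a b c d e =>
  f a b c d e + f a b c (- d) e + f a b (- c) d e + f a b (- c) (- d) e +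
  f a (- b) c d e + f a (- b) c (- d) e + f a (- b) (- c) d e +
  f a (- b) (- c) (- d) e).
Proof.
have avg g h : Sum5 (fun a b c d e => g a b c d e + h a b c d e) = Sum5 g + Sum5 h.
  by rewrite /Sum5 big_split.
rewrite !avg.
have [f1 f2 f3] := sum5_sign f.
have [_ f12 f13] := sum5_sign (fun a b c d e => f a (- b) c d e).
have [_ _ f23] := sum5_sign (fun a b c d e => f a b (- c) d e).
have [_ _ f123] := sum5_sign (fun a b c d e => f a (- b) (- c) d e).
rewrite f123 f12 f13 f23 f1 f2 f3.
by ring.
Qed.

(** [g] models the half Hadamard matrix on both blocks, through the first coordinate of each image
    block. *)
Variable g : 'rV[R]_8 -> 'rV[R]_8.
Hypothesis t_g : perm_eq (map g t) t.
Hypothesis g0E : forall x, g x 0 (o8 0) =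
  (x 0 (o8 0) + x 0 (o8 1) + x 0 (o8 2) + x 0 (o8 3)) / 2.
Hypothesis g4E : forall x, g x 0 (o8 4) =
  (x 0 (o8 4) + x 0 (o8 5) + x 0 (o8 6) + x 0 (o8 7)) / 2.

(** The even part of ((a + b + c + d) / 2)^4 has coefficients 1/16 and 6/16, so invariance under [g]
    reads S4 = (4 S4 + 36 S22) / 16. *)
Lemma E8_moment4 : \sum_(x <- t) x 0 (o8 0) ^+ 4 =
  3 * \sum_(x <- t) x 0 (o8 0) ^+ 2 * x 0 (o8 1) ^+ 2.
Proof.
pose S i j := \sum_(x <- t) x 0 i ^+ 2 * x 0 j ^+ 2.
have S_tperm a b i j k : (fun i _ j => S i j) i j k =
   (fun i _ j => S i j) (tperm a b i) (tperm a b j) (tperm a b k).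
  by rewrite /= {1}/S -(sum_tperm t_inv a b); apply: eq_bigr => x _; rewrite !mxE.
have S1 i : S i i = S (o8 0) (o8 0).
  exact: (tperm_invariant1 S_tperm).
have S2 i j : i != j -> S i j = S (o8 0) (o8 1).
  by move=> ij; apply: (tperm_invariant2 S_tperm ij).
have -> : \sum_(x <- t) x 0 (o8 0) ^+ 4 = S (o8 0) (o8 0).
  by apply: eq_bigr => x _; rewrite -exprD.
have := sum5_average (fun a b c d _ => ((a + b + c + d) / 2) ^+ 4).
have -> : Sum5 (fun a b c d _ => ((a + b + c + d) / 2) ^+ 4) = S (o8 0) (o8 0).
  rewrite -[RHS](sum_invariant _ t_g); apply: eq_bigr => x _.
  by rewrite g0E -exprD.
rewrite (@sum5_ext _ (fun a b c d _ =>
    (a ^+ 2 * a ^+ 2 + b ^+ 2 * b ^+ 2 + c ^+ 2 * c ^+ 2 + d ^+ 2 * d ^+ 2) / 2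
    + 3 * (a ^+ 2 * b ^+ 2 + a ^+ 2 * c ^+ 2 + a ^+ 2 * d ^+ 2 + b ^+ 2 * c ^+ 2
        + b ^+ 2 * d ^+ 2 + c ^+ 2 * d ^+ 2))) => [|a b c d e]; last by field.
rewrite /Sum5 big_split -mulr_suml -mulr_sumr !big_split /= -!/(S _ _) !S1.
set s4 := S (o8 0) (o8 0); rewrite !S2 //.
by lra.
Qed.

(** Expanding the images of x_0^6 and x_0^4 x_4^2 gives S6 = 3 S42 + 6 S222 and S42 = 3 S222; hence
    S6 = 15 S222, and 15 - 45 + 30 = 0. *)
Lemma E8_moment6 : qmoment t (o8 0) (o8 0) (o8 0) -
  15 * qmoment t (o8 0) (o8 0) (o8 1) + 30 * qmoment t (o8 0) (o8 1) (o8 2) = 0.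
Proof.
have q_tperm := qmoment_tperm t_inv.
pose q := qmoment t.
have q1 i : q i i i = q (o8 0) (o8 0) (o8 0) by apply: tperm_invariant1 q_tperm _ _.
have q2 i j : i != j -> q i i j = q (o8 0) (o8 0) (o8 1).
  by move=> ij; apply: tperm_invariant2 q_tperm _ _ _ _ ij _.
have q2' i j : i != j -> q i j j = q (o8 0) (o8 0) (o8 1).
  move=> ij; rewrite -(q2 j i) 1?eq_sym //.
  by apply: eq_bigr => x _; rewrite -mulrA mulrC.
have q3 i j k : uniq [:: i; j; k] -> q i j k = q (o8 0) (o8 1) (o8 2).
  by move=> u; apply: tperm_invariant3 q_tperm _ _ _ _ _ _ u _.
have rel6 : q (o8 0) (o8 0) (o8 0) =
    3 * q (o8 0) (o8 0) (o8 1) + 6 * q (o8 0) (o8 1) (o8 2).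
  have := sum5_average (fun a b c d _ => ((a + b + c + d) / 2) ^+ 6).
  have -> : Sum5 (fun a b c d _ => ((a + b + c + d) / 2) ^+ 6) = q (o8 0) (o8 0) (o8 0).
    rewrite -[RHS](sum_invariant _ t_g); apply: eq_bigr => x _.
    by rewrite g0E -!exprD.
  rewrite (@sum5_ext _ (fun a b c d _ =>
        (a ^+ 2 * a ^+ 2 * a ^+ 2 + b ^+ 2 * b ^+ 2 * b ^+ 2
        + c ^+ 2 * c ^+ 2 * c ^+ 2 + d ^+ 2 * d ^+ 2 * d ^+ 2) / 8
      + (15 / 8) * (a ^+ 2 * a ^+ 2 * b ^+ 2 + a ^+ 2 * a ^+ 2 * c ^+ 2
        + a ^+ 2 * a ^+ 2 * d ^+ 2 + b ^+ 2 * b ^+ 2 * c ^+ 2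
        + b ^+ 2 * b ^+ 2 * d ^+ 2 + c ^+ 2 * c ^+ 2 * d ^+ 2
        + a ^+ 2 * b ^+ 2 * b ^+ 2 + a ^+ 2 * c ^+ 2 * c ^+ 2
        + a ^+ 2 * d ^+ 2 * d ^+ 2 + b ^+ 2 * c ^+ 2 * c ^+ 2
        + b ^+ 2 * d ^+ 2 * d ^+ 2 + c ^+ 2 * d ^+ 2 * d ^+ 2)
      + (90 / 8) * (a ^+ 2 * b ^+ 2 * c ^+ 2 + a ^+ 2 * b ^+ 2 * d ^+ 2
        + a ^+ 2 * c ^+ 2 * d ^+ 2 + b ^+ 2 * c ^+ 2 * d ^+ 2)))
    => [|a b c d e]; last by field.
  rewrite /Sum5 !big_split -mulr_suml -!mulr_sumr !big_split /=.
  rewrite -!/(qmoment _ _ _ _) -/q.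
  rewrite !q1; set s6 := q (o8 0) (o8 0) (o8 0); rewrite !q2 // !q2' //.
  set s42 := q (o8 0) (o8 0) (o8 1); rewrite !q3 //.
  by lra.
pose A (x : 'rV[R]_8) := ((x 0 (o8 0) + x 0 (o8 1) + x 0 (o8 2) + x 0 (o8 3)) / 2) ^+ 4.
have rel42 : q (o8 0) (o8 0) (o8 1) = 3 * q (o8 0) (o8 1) (o8 2).
  have := sum5_average (fun a b c d e => ((a + b + c + d) / 2) ^+ 4 * e ^+ 2).
  have -> : Sum5 (fun a b c d e => ((a + b + c + d) / 2) ^+ 4 * e ^+ 2)
      = q (o8 0) (o8 0) (o8 1).
    have -> : Sum5 (fun a b c d e => ((a + b + c + d) / 2) ^+ 4 * e ^+ 2)
        = \sum_(x <- t) A x * x 0 (o8 4) ^+ 2 by [].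
    rewrite -(q2 (o8 0) (o8 4)) // /q /qmoment -[RHS](sum_invariant _ t_g).
    have AE (p : 'I_8) : (3 < p)%N ->
        \sum_(x <- t) A x * x 0 p ^+ 2 = \sum_(x <- t) A x * x 0 (o8 4) ^+ 2.
      move=> p3; rewrite -(sum_tperm t_inv (o8 4) p); apply: eq_bigr => x _.
      rewrite /A !mxE tpermR.
      by rewrite !tpermD //; apply: contraTneq p3 => ->.
    pose E (x : 'rV[R]_8) :=
      A x * ((x 0 (o8 4) + x 0 (o8 5) + x 0 (o8 6) + x 0 (o8 7)) / 2) ^+ 2.
    transitivity (\sum_(x <- t) E x); last first.
      by apply: eq_bigr => x _; rewrite /E /A g0E g4E -!exprD.
    (* The identity and the flips of 4 with 5, 6 and 7 give four sign patterns whose sum cancels all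
       cross products in the square of the second block sum. *)
    have Eflip (p : 'I_8) : (4 < p)%N ->
        \sum_(x <- t) E x = \sum_(x <- t) E (flip2 (o8 4) p x).
      move=> p4; rewrite (sum_invariant _ (t_inv.2 (o8 4) p _)) //.
      by apply: contraTneq p4 => <-.
    suff : 4 * \sum_(x <- t) E x = 4 * \sum_(x <- t) A x * x 0 (o8 4) ^+ 2 by lra.
    transitivity (\sum_(x <- t) E x + \sum_(x <- t) E (flip2 (o8 4) (o8 5) x)
      + \sum_(x <- t) E (flip2 (o8 4) (o8 6) x)
      + \sum_(x <- t) E (flip2 (o8 4) (o8 7) x)).
      by rewrite -!Eflip //; ring.
    transitivity (\sum_(x <- t) A x * x 0 (o8 4) ^+ 2
      + \sum_(x <- t) A x * x 0 (o8 5) ^+ 2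
      + \sum_(x <- t) A x * x 0 (o8 6) ^+ 2 + \sum_(x <- t) A x * x 0 (o8 7) ^+ 2).
      rewrite -!big_split; apply: eq_bigr => x _.
      by rewrite /E /A !mxE /=; field.
    by rewrite (AE (o8 5)) // (AE (o8 6)) // (AE (o8 7)) //; ring.
  rewrite (@sum5_ext _ (fun a b c d e =>
        (a ^+ 2 * a ^+ 2 * e ^+ 2 + b ^+ 2 * b ^+ 2 * e ^+ 2
        + c ^+ 2 * c ^+ 2 * e ^+ 2 + d ^+ 2 * d ^+ 2 * e ^+ 2) / 2 +
      3 * (a ^+ 2 * b ^+ 2 * e ^+ 2 + a ^+ 2 * c ^+ 2 * e ^+ 2
        + a ^+ 2 * d ^+ 2 * e ^+ 2
        + b ^+ 2 * c ^+ 2 * e ^+ 2 + b ^+ 2 * d ^+ 2 * e ^+ 2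
        + c ^+ 2 * d ^+ 2 * e ^+ 2))) => [|a b c d e]; last by field.
  rewrite /Sum5 !big_split -mulr_suml -!mulr_sumr !big_split /=.
  rewrite -!/(qmoment _ _ _ _) -/q.
  rewrite !q2 //; set s42 := q (o8 0) (o8 0) (o8 1); rewrite !q3 //.
  by lra.
by move: rel6 rel42; rewrite /q; lra.
Qed.

End E8Moments.

(** * Shells as integer vectors *)

Definition nrm n (y : 'rV[int]_n) : int := \sum_i y 0 i ^+ 2.

(* Vectors are doubled to have integer entries: [lat 0] is [2 W_n] and, for
   [n = 4 mod 8], [lat 2] is twice the shadow. *)
Definition lat n (e : int) (y : 'rV[int]_n) : bool :=
  [forall i, forall j, (2 %| (y 0 i - y 0 j)%R)%Z] && (4 %| (\sum_i y 0 i - e)%R)%Z.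

Definition half (R : realType) n (y : 'rV[int]_n) : 'rV[R]_n :=
  \row_i ((y 0 i)%:~R / 2).

(** For a finite shell mapped into itself, being an involution supplies bijectivity. *)
Definition lat_isometry n e (g : 'rV[int]_n -> 'rV[int]_n) : Prop :=
  forall y, lat e y -> [/\ lat e (g y), nrm (g y) = nrm y & g (g y) = y].

Lemma finite_rows n (p : pred 'rV[int]_n) (M : int) :
  (forall y, p y -> nrm y = M) ->
  exists t : seq 'rV[int]_n, uniq t /\ forall y, (y \in t) = p y.
Proof.
move=> pM; pose N := `|M|%N.
(* The square of an entry is at most [N], so the entry lies between [-N] and [N]; shifting by [N]
   codes it as an ordinal. *)
pose row (f : {ffun 'I_n -> 'I_(N + N).+1}) : 'rV[int]_n :=
  \row_i ((f i)%:Z - N%:Z).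
exists (undup [seq y <- map row (enum {ffun 'I_n -> 'I_(N + N).+1}) | p y]).
split=> [|y]; first exact: undup_uniq.
rewrite mem_undup mem_filter; have [py|//] := boolP (p y).
have yN i : - N%:Z <= y 0 i <= N%:Z.
  have : y 0 i ^+ 2 <= N%:Z.
    apply: le_trans (_ : nrm y <= _); last by rewrite (pM _ py) /N; lia.
    by rewrite /nrm (bigD1 i) //= lerDl sumr_ge0 // => j _; rewrite sqr_ge0.
  by rewrite expr2; nia.
apply/mapP; exists [ffun i => inord (absz (y 0 i + N%:Z))]; first by rewrite mem_enum.
apply/rowP => i; rewrite mxE ffunE inordK; have := yN i; lia.
Qed.

Lemma perm_involution (T : eqType) (t : seq T) (g : T -> T) : uniq t ->
  {in t, forall x, g x \in t} -> {in t, forall x, g (g x) = x} ->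
  perm_eq (map g t) t.
Proof.
move=> ut gt gg; apply: uniq_perm => // [|x].
  by rewrite map_inj_in_uniq // => x y xt yt e; rewrite -(gg x) // e gg.
apply/mapP/idP => [[y yt ->]|xt]; first exact: gt.
by exists (g x); rewrite ?gg ?gt.
Qed.

Lemma latP n e (y : 'rV[int]_n) :
  reflect ((forall i j, (2 %| (y 0 i - y 0 j)%R)%Z) /\
    (4 %| (\sum_i y 0 i - e)%R)%Z) (lat e y).
Proof.
apply: (iffP andP) => -[h1 h2]; split=> //.
  by move=> i j; move/forallP/(_ i)/forallP/(_ j): h1.
by apply/forallP => i; apply/forallP.
Qed.

Lemma sum_xcol n (i j : 'I_n) (y : 'rV[int]_n) (f : int -> int) :
  \sum_k f (xcol i j y 0 k) = \sum_k f (y 0 k).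
Proof.
rewrite [RHS](reindex_inj (@perm_inj _ (tperm i j))) /=.
by apply: eq_bigr => k _; rewrite mxE.
Qed.

Lemma xcol_isometry n e (i j : 'I_n) : lat_isometry e (xcol i j).
Proof.
move=> y /latP[par sm]; split.
- apply/latP; split=> [k l|]; first by rewrite !mxE.
  by rewrite (sum_xcol i j y id).
- by rewrite /nrm (sum_xcol i j y (fun z => z ^+ 2)).
- by apply/rowP => k; rewrite !mxE tpermK.
Qed.

Lemma flip2_intE n (i j : 'I_n) (y : 'rV[int]_n) k :
  flip2 i j y 0 k = if (k == i) || (k == j) then - y 0 k else y 0 k.
Proof. by rewrite mxE. Qed.

(** Up to sign, the coordinate sum changes by twice the even number y_i + y_j, a multiple of 4. *)
Lemma flip2_isometry n e (i j : 'I_n) : i != j -> lat_isometry e (flip2 i j).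
Proof.
move=> ij y /latP[par sm]; split.
- apply/latP; split=> [k l|].
    by have := par k l; rewrite !flip2_intE; do 2!case: ifP => _; lia.
  have sumD2 (F : 'I_n -> int) : \sum_k F k =
      F i + (F j + \sum_(k | (k != i) && (k != j)) F k).
    by rewrite (bigD1 i) //= (bigD1 j) 1?eq_sym.
  move: sm; have := par i j; rewrite !sumD2 !flip2_intE !eqxx orbT /=.
  have -> : \sum_(k | (k != i) && (k != j)) flip2 i j y 0 k =
      \sum_(k | (k != i) && (k != j)) y 0 k.
    by apply: eq_bigr => k /andP[ki kj]; rewrite flip2_intE (negbTE ki) (negbTE kj).
  by move: (\sum_(k | (k != i) && (k != j)) y 0 k) => s; lia.
- by rewrite /nrm; apply: eq_bigr => k _; rewrite flip2_intE; case: ifP; rewrite ?sqrrN.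
- by apply/rowP => k; rewrite !flip2_intE; case: (_ || _); rewrite ?opprK.
Qed.

Lemma half_D_invariant (R : realType) n (t : seq 'rV[int]_n) :
  D_invariant t -> D_invariant (map (@half R n) t).
Proof.
have commute g g' : (forall y, g (@half R n y) = half R (g' y)) ->
    perm_eq (map g' t) t -> perm_eq (map g (map (@half R n) t)) (map (@half R n) t).
  move=> gg' ?; rewrite -map_comp (eq_map (g := half R (n:=n) \o g')) // map_comp.
  exact: perm_map.
case=> tx tf; split=> i j.
  by apply: commute (tx i j) => y; apply/rowP => k; rewrite !mxE.
move/(tf i j); apply: commute => y; apply/rowP => k; rewrite !mxE.
by case: ifP => // _; rewrite mulrNz mulNr.
Qed.

Lemma lat_shell_isometry n e M (t : seq 'rV[int]_n) g :
  uniq t -> (forall y, (y \in t) = lat e y && (nrm y == M)) ->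
  lat_isometry e g -> perm_eq (map g t) t.
Proof.
move=> ut tE ig; apply: perm_involution => // y;
  rewrite tE => /andP[/ig[ly ny gg] /eqP nM] //.
by rewrite tE ly ny nM eqxx.
Qed.

Lemma lat_shell_D_invariant n e M (t : seq 'rV[int]_n) :
  uniq t -> (forall y, (y \in t) = lat e y && (nrm y == M)) -> D_invariant t.
Proof.
move=> ut tE; split=> [i j|i j ij].
  exact: (lat_shell_isometry ut tE (@xcol_isometry n e i j)).
exact: (lat_shell_isometry ut tE (@flip2_isometry _ e _ _ ij)).
Qed.

Lemma intr_div_int (R : realType) (a d : int) : d != 0 ->
  (a%:~R / d%:~R : R) \is a Num.int = (d %| a)%Z.
Proof.
move=> d0; have d0R : d%:~R != 0 :> R by rewrite intr_eq0.
apply/intrP/dvdzP => -[m]; last first.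
  by move=> ->; exists m; rewrite intrM mulfK.
move/(canRL (mulfVK d0R)); rewrite -intrM => /eqP; rewrite eqr_int => /eqP ->.
by exists m.
Qed.

(** The parameter serves both sets: [e = 0] is the condition of W_n, and [e = 2] asks for an odd
    coordinate sum, as in the shadow for n = 4 mod 8. *)
Lemma half_lattice (R : realType) n e (x : 'rV[R]_n) : (0 < n)%N ->
  ((forall i : 'I_n, 2 * Defs.coord x i \is a Num.int) /\
   (forall (h : (0 < n)%N) (i : 'I_n),
      Defs.coord x i - Defs.coord x (Ordinal h) \is a Num.int) /\
   ((\sum_(i < n) Defs.coord x i - e%:~R / 2) / 2 \is a Num.int)) <->
  (exists2 y, x = half R y & lat e y).
Proof.
move=> n0.
have dE (y : 'rV[int]_n) i j : Defs.coord (half R y) i - Defs.coord (half R y) j =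
    (y 0 i - y 0 j)%:~R / 2%:~R.
  by rewrite /Defs.coord !mxE intrB mulrBl.
have sE (y : 'rV[int]_n) : (\sum_(i < n) Defs.coord (half R y) i - e%:~R / 2) / 2 =
    (\sum_i y 0 i - e)%:~R / 4%:~R.
  rewrite /Defs.coord (eq_bigr (fun i => (y 0 i)%:~R / 2)); last first.
    by move=> i _; rewrite mxE.
  rewrite -mulr_suml -mulrBl -mulrA intrB raddf_sum /=; congr (_ * _).
  by rewrite -invfM -natrM.
split=> [[x2 [xd xs]]|[y -> /latP[par sm]]].
  have xE : x = half R (\row_i Num.floor (2 * Defs.coord x i)).
    by apply/rowP => i; rewrite !mxE floorK ?x2 // mulrC mulKf ?pnatr_eq0.
  exists (\row_i Num.floor (2 * Defs.coord x i)) => //.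
  rewrite xE in xd xs; set y := (\row_i _) in xE xd xs *.
  apply/latP; split=> [i j|]; last by rewrite -(intr_div_int R) // -sE.
  have := xd n0 i; have := xd n0 j; rewrite !dE !intr_div_int //.
  by lia.
split=> [i|]; first by rewrite /Defs.coord mxE mulrC divfK ?pnatr_eq0 // intr_int.
split=> [h i|]; last by rewrite sE intr_div_int.
by rewrite dE intr_div_int.
Qed.

Lemma half_dotp (R : realType) n (y : 'rV[int]_n) :
  dotp (half R y) (half R y) = (nrm y)%:~R / 4.
Proof.
rewrite /dotp /nrm /Defs.coord raddf_sum mulr_suml; apply: eq_bigr => i _.
by rewrite !mxE /= rmorphXn /=; field.
Qed.

Lemma half_inj (R : realType) n : injective (@half R n).
Proof.
move=> y z /rowP e; apply/rowP => i; have := e i; rewrite !mxE.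
by move/(mulIf (invr_neq0 _)) => /(_ _)/eqP; rewrite pnatr_eq0 eqr_int => /(_ isT)/eqP.
Qed.

(** A point of the shell shows that [m] is [M / 4] for an integer [M], so the shell comes from the
    finitely many doubled vectors of norm [M]. *)
Lemma shell_enum (R : realType) n e (A : 'rV[R]_n -> Prop) (m : R) :
  (forall x, A x <-> exists2 y, x = half R y & lat e y) ->
  nonempty (shell A m) ->
  exists (M : int) (t : seq 'rV[int]_n),
    [/\ uniq t, forall y, (y \in t) = lat e y && (nrm y == M)
      & enumerates (map (@half R n) t) (shell A m)].
Proof.
move=> AE [x0 [/AE[y0 -> _]]]; rewrite half_dotp => mE.
have [|t [ut tE]] := @finite_rows n (fun y => lat e y && (nrm y == nrm y0)) (nrm y0).
  by move=> y /andP[_ /eqP].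
exists (nrm y0), t; split=> //; split=> [|x].
  by rewrite map_inj_uniq //; apply: half_inj.
split=> [/mapP[y]|[/AE[y -> ly]]].
  rewrite tE => /andP[ly /eqP ny ->]; split; first by apply/AE; exists y.
  by rewrite half_dotp ny.
rewrite half_dotp -mE => /(mulIf (invr_neq0 _)) => /(_ _)/eqP.
rewrite pnatr_eq0 eqr_int => /(_ isT) ny.
by apply: map_f; rewrite tE ly.
Qed.

Lemma W_latticeE (R : realType) n (x : 'rV[R]_n) : (0 < n)%N ->
  W_lattice x <-> exists2 y, x = half R y & lat 0 y.
Proof. by move=> n0; rewrite -half_lattice // mul0r subr0. Qed.

Lemma W_shadowE (R : realType) n (x : 'rV[R]_n) : (0 < n)%N ->
  W_shadow x <-> exists2 y, x = half R y & lat (if (8 %| n)%N then 0 else 2) y.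
Proof.
move=> n0; rewrite /W_shadow; case: ifP => _; first exact: W_latticeE.
by rewrite -half_lattice // divff // pnatr_eq0.
Qed.

Lemma shell_cond_C2 (R : realType) n e (A : 'rV[R]_n -> Prop) (m : R) : (2 < n)%N ->
  (forall x, A x <-> exists2 y, x = half R y & lat e y) ->
  nonempty (shell A m) -> cond_C 2 (shell A m).
Proof.
move=> n2 AE /(shell_enum AE)[M [t [ut tE en]]].
exists (map (@half R n) t); split=> // P; apply: harmonic2_sum0 => //.
exact/half_D_invariant/(lat_shell_D_invariant ut tE).
Qed.

(** * Blocks of four coordinates and triality *)

Local Notation blk := (int * int * int * int)%type.

Definition block_seq (y : blk) : seq int := let: (a, b, c, d) := y in [:: a; b; c; d].

Definition block_norm (y : blk) : int :=
  let: (a, b, c, d) := y in a ^+ 2 + b ^+ 2 + c ^+ 2 + d ^+ 2.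

(* [block_ok] describes twice the dual lattice of D4, and [block_class] the four
   classes of D4*/D4: (false, false), (false, true), (true, false), (true, true)
   are the root, vector, spinor and conjugate spinor classes. *)
Definition block_ok (y : blk) : bool := let: (a, b, c, d) := y in
  [&& (2 %| b - a)%Z, (2 %| c - a)%Z & (2 %| d - a)%Z].

Definition block_class (y : blk) : bool * bool := let: (a, b, c, d) := y in
  (~~ (2 %| a)%Z, ~~ (4 %| a + b + c + d)%Z).

(** Half a Hadamard matrix of order 4, symmetric and orthogonal; the divisions are exact under
    [block_ok]. *)
Definition block_hadamard (y : blk) : blk := let: (a, b, c, d) := y in
  (((a + b + c + d) %/ 2)%Z, ((a + b - c - d) %/ 2)%Z,
   ((a - b + c - d) %/ 2)%Z, ((a - b - c + d) %/ 2)%Z).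

Definition block_flip (y : blk) : blk := let: (a, b, c, d) := y in (a, b, c, - d).

(* The harmonic sextic invariant of the Weyl group of F4. *)
Definition sextic (R : pzRingType) (a b c d : R) : R :=
  a ^+ 6 + b ^+ 6 + c ^+ 6 + d ^+ 6
  - 5 * (a ^+ 4 * b ^+ 2 + a ^+ 4 * c ^+ 2 + a ^+ 4 * d ^+ 2
       + b ^+ 4 * a ^+ 2 + b ^+ 4 * c ^+ 2 + b ^+ 4 * d ^+ 2
       + c ^+ 4 * a ^+ 2 + c ^+ 4 * b ^+ 2 + c ^+ 4 * d ^+ 2
       + d ^+ 4 * a ^+ 2 + d ^+ 4 * b ^+ 2 + d ^+ 4 * c ^+ 2)
  + 30 * (a ^+ 2 * b ^+ 2 * c ^+ 2 + a ^+ 2 * b ^+ 2 * d ^+ 2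
       + a ^+ 2 * c ^+ 2 * d ^+ 2 + b ^+ 2 * c ^+ 2 * d ^+ 2).

Definition block_sextic (y : blk) : int := let: (a, b, c, d) := y in sextic a b c d.

(** [f] is the permutation of the classes of D4*/D4 induced by [g]. *)
Definition block_symmetry (g : blk -> blk) (f : bool * bool -> bool * bool) : Prop :=
  involutive f /\ forall y, block_ok y ->
    [/\ block_ok (g y), block_norm (g y) = block_norm y,
        block_sextic (g y) = block_sextic y,
        block_class (g y) = f (block_class y) & g (g y) = y].

Lemma id_symmetry : block_symmetry id id.
Proof. by split. Qed.

(** The sum changes by 2d, which matters modulo 4 exactly when the entries are odd: the two spinor
    classes are exchanged. *)
Lemma flip_symmetry : block_symmetry block_flip (fun u => (u.1, u.1 (+) u.2)).
Proof.
split=> [[[] []] //|[[[a b] c] d] /and3P[h1 h2 h3]].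
split; rewrite /block_flip //=.
- by apply/and3P; split; lia.
- by rewrite sqrrN.
- by rewrite /sextic; ring.
- congr pair; have [ae|ao] := boolP (2 %| a)%Z;
    by have [se|so] := boolP (4 %| a + b + c + d)%Z => /=; lia.
- by rewrite opprK.
Qed.

(** The first image coordinate is half the old sum, and the image coordinates add up to 2a; so the
    two class bits change places, exchanging vector and spinor. *)
Lemma hadamard_symmetry : block_symmetry block_hadamard (fun u => (u.2, u.1)).
Proof.
split=> [[[] []] //|[[[a b] c] d] /and3P[h1 h2 h3]].
rewrite /block_hadamard.
have e1 : 2 * ((a + b + c + d) %/ 2)%Z = a + b + c + d by lia.
have e2 : 2 * ((a + b - c - d) %/ 2)%Z = a + b - c - d by lia.
have e3 : 2 * ((a - b + c - d) %/ 2)%Z = a - b + c - d by lia.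
have e4 : 2 * ((a - b - c + d) %/ 2)%Z = a - b - c + d by lia.
move: ((a + b + c + d) %/ 2)%Z ((a + b - c - d) %/ 2)%Z ((a - b + c - d) %/ 2)%Z
  ((a - b - c + d) %/ 2)%Z e1 e2 e3 e4 => p q r s e1 e2 e3 e4.
split.
- by apply/and3P; split; lia.
- apply: (@mulfI _ (4 : int)) => //=.
  transitivity ((2 * p) ^+ 2 + (2 * q) ^+ 2 + (2 * r) ^+ 2 + (2 * s) ^+ 2).
    by ring.
  by rewrite e1 e2 e3 e4; ring.
(* The factor 64 = 2^6 clears the denominators of the sextic. *)
- apply: (@mulfI _ (64 : int)) => //=.
  transitivity (sextic (2 * p) (2 * q) (2 * r) (2 * s)); first by rewrite /sextic; ring.
  by rewrite e1 e2 e3 e4 /sextic; ring.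
- by congr pair => /=; lia.
- by congr (_, _, _, _); lia.
Qed.

Lemma conj_symmetry g f g' f' : block_symmetry g f -> block_symmetry g' f' ->
  block_symmetry (g \o g' \o g) (f \o f' \o f).
Proof.
move=> [ff gP] [ff' gP']; split=> [u|y oky] /=; first by rewrite ff ff' ff.
have [ok1 n1 s1 c1 gg1] := gP _ oky.
have [ok2 n2 s2 c2 gg2] := gP' _ ok1.
have [ok3 n3 s3 c3 gg3] := gP _ ok2.
by split; rewrite ?n3 ?n2 ?s3 ?s2 ?c3 ?c2 ?c1 ?gg3 ?gg2.
Qed.

(** The two maps induce transpositions that generate the symmetric group on the nonzero classes;
    flip, Hadamard, flip takes the conjugate spinor class to the vector class. *)
Lemma triality u : exists g f, block_symmetry g f /\ f u = (false, u.1 || u.2).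
Proof.
case: u => [[] []].
- exists (block_flip \o block_hadamard \o block_flip); eexists.
  by split; [exact: conj_symmetry flip_symmetry hadamard_symmetry|].
- by exists block_hadamard; eexists; split; first exact: hadamard_symmetry.
- by exists id; eexists; split; first exact: id_symmetry.
- by exists id; eexists; split; first exact: id_symmetry.
Qed.

(** * Gluing two and four copies of D4 *)

Definition row_of_seq n (s : seq int) : 'rV[int]_n := \row_i nth 0 s i.

Lemma nrm_row_of_seq n s : size s = n -> nrm (row_of_seq n s) = \sum_(z <- s) z ^+ 2.
Proof.
move=> <-; rewrite (big_nth 0) big_mkord /nrm.
by apply: eq_bigr => i _; rewrite mxE.
Qed.

Lemma lat_row_of_seq n e s : size s = n -> (0 < n)%N -> lat e (row_of_seq n s) =
  all (fun z => (2 %| z - nth 0%R s 0)%Z) s && (4 %| (\sum_(z <- s) z - e)%R)%Z.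
Proof.
move=> sn n0; apply/latP/andP => -[par sm]; split.
- apply/(all_nthP 0) => i; rewrite sn => lin.
  by have := par (Ordinal lin) (Ordinal n0); rewrite !mxE.
- move: sm; rewrite (big_nth 0) big_mkord sn.
  by congr ((_ %| _ - _)%Z); apply: eq_bigr => i _; rewrite mxE.
- move=> i j; rewrite !mxE.
  have h k : (k < n)%N -> (2 %| nth 0%R s k - nth 0%R s 0)%Z.
    by move=> lkn; apply: (all_nthP 0 par); rewrite sn.
  move: (nth 0 s i) (nth 0 s j) (nth 0 s 0) (h i (ltn_ord i)) (h j (ltn_ord j)).
  by move=> x y z; lia.
- move: sm; rewrite (big_nth 0) big_mkord sn.
  by congr ((_ %| _ - _)%Z); apply: eq_bigr => i _; rewrite mxE.
Qed.

Lemma block_parity (y : blk) (z : int) :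
  all (fun u => (2 %| u - z)%Z) (block_seq y) =
  block_ok y && (2 %| (block_seq y)`_0 - z)%Z.
Proof. by case: y => [[[a b] c] d] /=; apply/idP/idP; lia. Qed.

Lemma block_sum_even (y : blk) : block_ok y -> (2 %| (\sum_(u <- block_seq y) u)%R)%Z.
Proof.
by case: y => [[[a b] c] d] /and3P[h1 h2 h3]; rewrite !big_cons big_nil; lia.
Qed.

Lemma block_classE (y : blk) : block_class y =
  (~~ (2 %| (block_seq y)`_0)%Z, ~~ (4 %| (\sum_(u <- block_seq y) u)%R)%Z).
Proof.
case: y => [[[a b] c] d] /=; rewrite !big_cons big_nil.
by rewrite (_ : a + (b + (c + (d + 0))) = a + b + c + d) //; ring.
Qed.

Lemma dvd2_sub (a b : int) : (2 %| b - a)%Z = (~~ (2 %| a)%Z == ~~ (2 %| b)%Z).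
Proof. by apply/idP/idP; lia. Qed.

(** Even integers modulo 4 form a group of order 2, so the second class bit adds up over blocks. *)
Lemma dvd4_add (s s' : int) : (2 %| s)%Z -> (2 %| s')%Z ->
  (4 %| s + s')%Z = ~~ (~~ (4 %| s)%Z (+) ~~ (4 %| s')%Z).
Proof.
move=> h h'; have [e|e] := boolP (4 %| s)%Z;
  by have [e'|e'] := boolP (4 %| s')%Z => /=; lia.
Qed.

Definition of_blocks2 (p : blk * blk) : 'rV[int]_8 :=
  row_of_seq 8 (block_seq p.1 ++ block_seq p.2).

Definition to_blocks2 (y : 'rV[int]_8) : blk * blk :=
  ((y 0 (o8 0), y 0 (o8 1), y 0 (o8 2), y 0 (o8 3)),
   (y 0 (o8 4), y 0 (o8 5), y 0 (o8 6), y 0 (o8 7))).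

Lemma to_blocks2K : cancel to_blocks2 of_blocks2.
Proof.
move=> y; apply/rowP => -[m lm]; rewrite mxE.
by do 8?[case: m lm => [|m] lm; first by congr (y 0 _); apply: val_inj].
Qed.

Lemma of_blocks2K : cancel of_blocks2 to_blocks2.
Proof. by move=> [[[[a b] c] d] [[[a' b'] c'] d']]; rewrite /to_blocks2 !mxE. Qed.

Lemma nrm_of_blocks2 p : nrm (of_blocks2 p) = block_norm p.1 + block_norm p.2.
Proof.
case: p => [[[[a b] c] d] [[[a' b'] c'] d']]; rewrite nrm_row_of_seq //=.
by rewrite !big_cons big_nil; ring.
Qed.

(** E8 is glued from two copies of D4 along the diagonal: common parity equates the first class
    bits, and divisibility of the sum by 4 equates the second. *)
Lemma lat_of_blocks2 p : lat 0 (of_blocks2 p) =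
  [&& block_ok p.1, block_ok p.2 & block_class p.1 == block_class p.2].
Proof.
case: p => [y0 y1] /=; rewrite lat_row_of_seq //=; last first.
  by case: y0 y1 => [[[? ?] ?] ?] [[[? ?] ?] ?].
rewrite (_ : nth 0 (_ ++ _) 0 = (block_seq y0)`_0); last by case: y0 => [[[? ?] ?] ?].
rewrite all_cat !block_parity !block_classE big_cat subr0 subrr dvdz0 andbT -andbA /=.
have [/block_sum_even s0|//] := boolP (block_ok y0).
have [/block_sum_even s1|//] := boolP (block_ok y1).
rewrite /= dvd2_sub dvd4_add // xpair_eqE; congr (_ && _).
by case: (4 %| _)%Z; case: (4 %| _)%Z.
Qed.

Definition hadamard2 (y : 'rV[int]_8) : 'rV[int]_8 :=
  let p := to_blocks2 y in of_blocks2 (block_hadamard p.1, block_hadamard p.2).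

Lemma hadamard2_isometry : lat_isometry 0 hadamard2.
Proof.
move=> y; rewrite -(to_blocks2K y); move: (to_blocks2 y) => p.
rewrite lat_of_blocks2 => /and3P[ok1 ok2 /eqP cl].
have [_ hP] := hadamard_symmetry.
have [ok1' n1 _ c1 h1] := hP _ ok1; have [ok2' n2 _ c2 h2] := hP _ ok2.
rewrite /hadamard2 !of_blocks2K h1 h2 !nrm_of_blocks2 /= n1 n2.
by rewrite lat_of_blocks2 /= ok1' ok2' c1 c2 cl eqxx -surjective_pairing.
Qed.

Definition hadamard2_real (R : realType) (x : 'rV[R]_8) : 'rV[R]_8 :=
  let had a b c d := [:: (a + b + c + d) / 2; (a + b - c - d) / 2;
                         (a - b + c - d) / 2; (a - b - c + d) / 2] in
  \row_i nth 0 (had (x 0 (o8 0)) (x 0 (o8 1)) (x 0 (o8 2)) (x 0 (o8 3)) ++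
                had (x 0 (o8 4)) (x 0 (o8 5)) (x 0 (o8 6)) (x 0 (o8 7))) i.

Lemma half_hadamard2 (R : realType) y : lat 0 y ->
  hadamard2_real (half R y) = half R (hadamard2 y).
Proof.
rewrite -{1}(to_blocks2K y) lat_of_blocks2 => /and3P[ok1 ok2 _].
have e (z : int) (r : R) : (2 %| z)%Z -> r = z%:~R / 2 ->
    r / 2 = ((z %/ 2)%Z)%:~R / 2.
  by move=> z2 ->; rewrite -{1}(divzK z2) intrM mulfK // intr_eq0.
move: ok1 ok2 => /and3P[h1 h2 h3] /and3P[h4 h5 h6].
apply/rowP => -[m lm]; rewrite !mxE.
by do 8![case: m lm => [|m] lm; first
  by rewrite /= ?mxE; apply: e; [lia|rewrite !(intrD, intrB); field]].
Qed.

Lemma half_hadamard2_perm (R : realType) (t : seq 'rV[int]_8) :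
  {in t, forall y, lat 0 y} -> perm_eq (map hadamard2 t) t ->
  perm_eq (map (@hadamard2_real R) (map (@half R 8) t)) (map (@half R 8) t).
Proof.
move=> tl th; rewrite -map_comp (_ : map _ t = map (@half R 8) (map hadamard2 t)).
  exact: perm_map.
by rewrite -map_comp; apply/eq_in_map => y /tl; apply: half_hadamard2.
Qed.

Lemma hadamard2_real0 (R : realType) (x : 'rV[R]_8) : hadamard2_real x 0 (o8 0) =
  (x 0 (o8 0) + x 0 (o8 1) + x 0 (o8 2) + x 0 (o8 3)) / 2.
Proof. by rewrite mxE. Qed.

Lemma hadamard2_real4 (R : realType) (x : 'rV[R]_8) : hadamard2_real x 0 (o8 4) =
  (x 0 (o8 4) + x 0 (o8 5) + x 0 (o8 6) + x 0 (o8 7)) / 2.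
Proof. by rewrite mxE. Qed.

(** The degrees 2, 4 and 6 all stay below 8, as the vanishing of odd moments demands. *)
Lemma W8_design7 (R : realType) (m : R) : nonempty (shell (@W_lattice R 8) m) ->
  design 7 (shell (@W_lattice R 8) m).
Proof.
move=> /(shell_enum (fun x : 'rV[R]_8 => W_latticeE x isT))[M [t [ut tE en]]].
have tD := half_D_invariant R (lat_shell_D_invariant ut tE).
have tl : {in t, forall y, lat 0 y} by move=> y; rewrite tE => /andP[].
have th := half_hadamard2_perm R tl (lat_shell_isometry ut tE hadamard2_isometry).
move=> j j7; exists (map (@half R 8) t); split=> // P.
have : [|| j == 1, j == 2 | j == 3]%N by lia.
case/or3P => /eqP ->.
- exact: harmonic2_sum0.
- apply: (@harmonic4_sum0 _ _ _ tD (o8 0) (o8 1)) => //.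
  exact: (E8_moment4 tD th (@hadamard2_real0 R)).
- apply: (@harmonic6_sum0 _ _ _ tD (o8 0) (o8 1) (o8 2)) => //.
  exact: (E8_moment6 tD th (@hadamard2_real0 R) (@hadamard2_real4 R)).
Qed.

(** * D16+ against E8 + E8 *)

(** The sextic has 4, 12 and 4 monomials of the three types, with coefficients 1, -5 and 30: the
    totals 4, -60 and 120 are 4 times 1, -15 and 30. *)
Lemma sum_sextic (R : realType) n (t : seq 'rV[R]_n) (i j k l : 'I_n) :
  D_invariant t -> uniq [:: i; j; k; l] ->
  \sum_(x <- t) sextic (x 0 i) (x 0 j) (x 0 k) (x 0 l) =
  4 * (qmoment t i i i - 15 * qmoment t i i j + 30 * qmoment t i j k).
Proof.
move=> tD; rewrite /= !inE !negb_or !andbT -!andbA.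
move=> /and5P[ij ik il jk /andP[jl kl]].
have q_tperm := qmoment_tperm tD; set q := qmoment t.
have q1 a : q a a a = q i i i by apply: tperm_invariant1 q_tperm _ _.
have q2 a b : a != b -> q a a b = q i i j.
  by move=> ab; apply: tperm_invariant2 q_tperm _ _ _ _ ab ij.
have q3 a b c : a != b -> a != c -> b != c -> q a b c = q i j k.
  move=> ab ac bc; apply: (tperm_invariant3 q_tperm).
    by rewrite /= !inE negb_or ab ac bc.
  by rewrite /= !inE negb_or ij ik jk.
transitivity (\sum_(x <- t) (
    (let s a b c := x 0 a ^+ 2 * x 0 b ^+ 2 * x 0 c ^+ 2 in
     s i i i + s j j j + s k k k + s l l l
     + (- 5) * (s i i j + s i i k + s i i l + s j j i + s j j k + s j j l
      + s k k i + s k k j + s k k l + s l l i + s l l j + s l l k)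
     + 30 * (s i j k + s i j l + s i k l + s j k l)))).
  by apply: eq_bigr => x _; rewrite /sextic; ring.
rewrite !big_split -!mulr_sumr !big_split /= -!/(qmoment _ _ _ _) -/q.
rewrite !q1 (q2 i k) // (q2 i l) // (q2 j i) 1?eq_sym // (q2 j k) // (q2 j l) //.
rewrite (q2 k i) 1?eq_sym // (q2 k j) 1?eq_sym // (q2 k l) //.
rewrite (q2 l i) 1?eq_sym // (q2 l j) 1?eq_sym // (q2 l k) 1?eq_sym //.
rewrite (q3 i j l) // (q3 i k l) // (q3 j k l) //.
by ring.
Qed.

Local Notation blk4 := ((blk * blk) * (blk * blk))%type.

Definition of_blocks4 (q : blk4) : 'rV[int]_16 :=
  row_of_seq 16 (block_seq q.1.1 ++ block_seq q.1.2 ++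
    block_seq q.2.1 ++ block_seq q.2.2).

Local Notation o16 k := (@Ordinal 16 k isT).

Definition to_blocks4 (y : 'rV[int]_16) : blk4 :=
  (((y 0 (o16 0), y 0 (o16 1), y 0 (o16 2), y 0 (o16 3)),
    (y 0 (o16 4), y 0 (o16 5), y 0 (o16 6), y 0 (o16 7))),
   ((y 0 (o16 8), y 0 (o16 9), y 0 (o16 10), y 0 (o16 11)),
    (y 0 (o16 12), y 0 (o16 13), y 0 (o16 14), y 0 (o16 15)))).

Lemma to_blocks4K : cancel to_blocks4 of_blocks4.
Proof.
move=> y; apply/rowP => -[m lm]; rewrite mxE.
by do 16?[case: m lm => [|m] lm; first by congr (y 0 _); apply: val_inj].
Qed.

Lemma of_blocks4K : cancel of_blocks4 to_blocks4.
Proof.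
move=> [[[[[? ?] ?] ?] [[[? ?] ?] ?]] [[[[? ?] ?] ?] [[[? ?] ?] ?]]].
by rewrite /to_blocks4 !mxE.
Qed.

Definition blocks4_ok (q : blk4) : bool :=
  [&& block_ok q.1.1, block_ok q.1.2, block_ok q.2.1 & block_ok q.2.2].

Definition blocks4_norm (q : blk4) : int :=
  block_norm q.1.1 + block_norm q.1.2 + (block_norm q.2.1 + block_norm q.2.2).

Lemma nrm_of_blocks4 q : nrm (of_blocks4 q) = blocks4_norm q.
Proof.
case: q => [[[[[? ?] ?] ?] [[[? ?] ?] ?]] [[[[? ?] ?] ?] [[[? ?] ?] ?]]].
by rewrite nrm_row_of_seq //= !big_cons big_nil /blocks4_norm /=; ring.
Qed.

Local Notation class := (bool * bool)%type.
Local Notation cl0 := (false, false).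
Local Notation clv := (false, true).
Local Notation cls := (true, false).
Local Notation clc := (true, true).

Definition word (q : blk4) : (class * class) * (class * class) :=
  ((block_class q.1.1, block_class q.1.2), (block_class q.2.1, block_class q.2.2)).

(* The glue codes of D16+ and of E8 + E8 over D4 + D4 + D4 + D4. *)
Definition D16_code : seq ((class * class) * (class * class)) :=
  [:: ((cl0, cl0), (cl0, cl0)); ((cl0, cl0), (clv, clv));
      ((cl0, clv), (cl0, clv)); ((cl0, clv), (clv, cl0));
      ((clv, cl0), (cl0, clv)); ((clv, cl0), (clv, cl0));
      ((clv, clv), (cl0, cl0)); ((clv, clv), (clv, clv));
      ((cls, cls), (cls, cls)); ((cls, cls), (clc, clc));
      ((cls, clc), (cls, clc)); ((cls, clc), (clc, cls));
      ((clc, cls), (cls, clc)); ((clc, cls), (clc, cls));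
      ((clc, clc), (cls, cls)); ((clc, clc), (clc, clc))].

Definition E8E8_code : seq ((class * class) * (class * class)) :=
  [:: ((cl0, cl0), (cl0, cl0)); ((cl0, cl0), (clv, clv));
      ((cl0, cl0), (cls, cls)); ((cl0, cl0), (clc, clc));
      ((clv, clv), (cl0, cl0)); ((clv, clv), (clv, clv));
      ((clv, clv), (cls, cls)); ((clv, clv), (clc, clc));
      ((cls, cls), (cl0, cl0)); ((cls, cls), (clv, clv));
      ((cls, cls), (cls, cls)); ((cls, cls), (clc, clc));
      ((clc, clc), (cl0, cl0)); ((clc, clc), (clv, clv));
      ((clc, clc), (cls, cls)); ((clc, clc), (clc, clc))].

Lemma D16_codeE w : (w \in D16_code) =
  [&& w.1.1.1 == w.1.2.1, w.1.1.1 == w.2.1.1, w.1.1.1 == w.2.2.1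
    & ~~ (w.1.1.2 (+) w.1.2.2 (+) (w.2.1.2 (+) w.2.2.2))].
Proof. by case: w => [[[[] []] [[] []]] [[[] []] [[] []]]]. Qed.

Lemma E8E8_codeE w : (w \in E8E8_code) = (w.1.1 == w.1.2) && (w.2.1 == w.2.2).
Proof. by case: w => [[[[] []] [[] []]] [[[] []] [[] []]]]. Qed.

(** Equal first class bits mean a common parity of all 16 entries; an even number of second bits set
    means a sum divisible by 4. *)
Lemma lat_of_blocks4 q : lat 0 (of_blocks4 q) = blocks4_ok q && (word q \in D16_code).
Proof.
rewrite D16_codeE; case: q => [[y0 y1] [y2 y3]].
rewrite lat_row_of_seq //=; last first.
  by case: y0 y1 y2 y3 => [[[? ?] ?] ?] [[[? ?] ?] ?] [[[? ?] ?] ?] [[[? ?] ?] ?].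
rewrite (_ : nth 0 (_ ++ _) 0 = (block_seq y0)`_0); last by case: y0 => [[[? ?] ?] ?].
rewrite !all_cat !block_parity !block_classE !big_cat subr0 subrr dvdz0 andbT /=.
rewrite /blocks4_ok /= addrA -!andbA.
have [/block_sum_even s0|//] := boolP (block_ok y0).
have [/block_sum_even s1|] := boolP (block_ok y1); last by [].
have [/block_sum_even s2|] := boolP (block_ok y2); last by rewrite !andbF.
have [/block_sum_even s3|] := boolP (block_ok y3); last by rewrite !andbF.
move: (\sum_(u <- block_seq y0) u) (\sum_(u <- block_seq y1) u)
  (\sum_(u <- block_seq y2) u) (\sum_(u <- block_seq y3) u) s0 s1 s2 s3.
move=> S0 S1 S2 S3 s0 s1 s2 s3; rewrite /= !dvd2_sub; do 3!congr (_ && _).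
rewrite (@dvd4_add (S0 + S1) (S2 + S3)) ?(@dvd4_add S0 S1) ?(@dvd4_add S2 S3)
  ?rpredD //.
by rewrite !negbK.
Qed.

(** * Comparison of the two glue codes inside the sum of four copies of D4* *)

Section BlockShell.
Variables (M : int) (tB : seq blk4).
Hypothesis tB_uniq : uniq tB.
Hypothesis tBE : forall q, (q \in tB) = blocks4_ok q && (blocks4_norm q == M).

(** The contribution of one glue word. The weight sees the first block alone, so the last three
    blocks can be permuted freely. *)
Let T w := \sum_(q <- tB | word q == w) block_sextic q.1.1.

Let T_symmetry (G : blk4 -> blk4) F w : involutive F ->
  (forall q, blocks4_ok q -> [/\ blocks4_ok (G q), blocks4_norm (G q) = blocks4_norm q,
     block_sextic (G q).1.1 = block_sextic q.1.1, word (G q) = F (word q)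
     & G (G q) = q]) ->
  T w = T (F w).
Proof.
move=> FF GP; have Gt : perm_eq (map G tB) tB.
  apply: perm_involution => // q; rewrite tBE => /andP[/GP[ok n _ _ GG] /eqP nM] //.
  by rewrite tBE ok n nM eqxx.
rewrite /T -(perm_big _ Gt) big_map big_seq_cond [RHS]big_seq_cond.
apply: eq_big => q.
  rewrite tBE; have [/GP[_ _ _ -> _]|//] := boolP (blocks4_ok q).
  by rewrite (inv_eq FF).
by rewrite tBE => /andP[/andP[/GP[]]].
Qed.

Let V b0 b1 b2 b3 := T (((false, b0), (false, b1)), ((false, b2), (false, b3))).

(** [tB] contains every quadruple of blocks of the given norm, so a separate triality map can act in
    each block. *)
Let T_triality u0 u1 u2 u3 : T ((u0, u1), (u2, u3)) =
  V (u0.1 || u0.2) (u1.1 || u1.2) (u2.1 || u2.2) (u3.1 || u3.2).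
Proof.
have [g0 [f0 [[ff0 gP0] e0]]] := triality u0.
have [g1 [f1 [[ff1 gP1] e1]]] := triality u1.
have [g2 [f2 [[ff2 gP2] e2]]] := triality u2.
have [g3 [f3 [[ff3 gP3] e3]]] := triality u3.
rewrite (@T_symmetry (fun q => ((g0 q.1.1, g1 q.1.2), (g2 q.2.1, g3 q.2.2)))
  (fun w => ((f0 w.1.1, f1 w.1.2), (f2 w.2.1, f3 w.2.2)))) /=.
- by rewrite e0 e1 e2 e3.
- by move=> [[a b] [c d]]; rewrite /= ff0 ff1 ff2 ff3.
move=> [[y0 y1] [y2 y3]] /and4P[/=].
move=> /gP0[? n0 ? c0 k0] /gP1[? n1 ? c1 k1] /gP2[? n2 ? c2 k2] /gP3[? n3 ? c3 k3].
split=> //; first exact/and4P.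
- by rewrite /blocks4_norm /= n0 n1 n2 n3.
- by rewrite /word /= c0 c1 c2 c3.
- by rewrite k0 k1 k2 k3.
Qed.

Let V_swap12 b0 b1 b2 b3 : V b0 b1 b2 b3 = V b0 b2 b1 b3.
Proof.
rewrite {1}/V (@T_symmetry (fun q => ((q.1.1, q.2.1), (q.1.2, q.2.2)))
  (fun w => ((w.1.1, w.2.1), (w.1.2, w.2.2)))) //; first by move=> [[a b] [c d]].
move=> [[y0 y1] [y2 y3]] /and4P[/= *]; split=> //; first exact/and4P.
by rewrite /blocks4_norm /=; ring.
Qed.

Let V_swap23 b0 b1 b2 b3 : V b0 b1 b2 b3 = V b0 b1 b3 b2.
Proof.
rewrite {1}/V (@T_symmetry (fun q => (q.1, (q.2.2, q.2.1)))
  (fun w => (w.1, (w.2.2, w.2.1)))) //; first by move=> [[a b] [c d]].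
move=> [[y0 y1] [y2 y3]] /and4P[/= *]; split=> //; first exact/and4P.
by rewrite /blocks4_norm /=; ring.
Qed.

Let sum_code (c : seq ((class * class) * (class * class))) : uniq c ->
  \sum_(q <- tB | word q \in c) block_sextic q.1.1 = \sum_(w <- c) T w.
Proof.
elim: c => [|w c IH] /=; first by rewrite big_nil big_pred0.
move=> /andP[wc uc]; rewrite big_cons -IH // (bigID (fun q => word q == w)) /=.
congr (_ + _); apply: eq_bigl => q; rewrite inE; case: eqP => [->|_] //=;
  by rewrite ?andbT ?andbF ?(negbTE wc).
Qed.

(** After triality, the D16+ code has 0000 once, each of the six words of weight 2 once and 1111
    nine times; the E8 + E8 code has 0000 once, 0011 and 1100 three times each and 1111 nine times.
    Permuting the last three places matches them. *)
Lemma D16_E8E8_sextic :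
  \sum_(q <- tB | word q \in D16_code) block_sextic q.1.1 =
  \sum_(q <- tB | word q \in E8E8_code) block_sextic q.1.1.
Proof.
rewrite !sum_code // /D16_code /E8E8_code !big_cons !big_nil !T_triality /=.
rewrite (V_swap12 false true false true) (V_swap23 false true true false).
rewrite (V_swap12 false true false true).
rewrite (V_swap23 true false false true) (V_swap12 true false true false).
by ring.
Qed.

(** Acting by [g] on the first copy of E8 and trivially on the second permutes the shell of E8 + E8.
    The first components then form an invariant multiset, in general with repetitions. *)
Lemma E8E8_perm g : lat_isometry 0 g ->
  perm_eq (map g [seq of_blocks2 q.1 | q <- tB & word q \in E8E8_code])
    [seq of_blocks2 q.1 | q <- tB & word q \in E8E8_code].
Proof.
move=> gi; pose G (q : blk4) : blk4 := (to_blocks2 (g (of_blocks2 q.1)), q.2).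
set tE := [seq q <- tB | _].
have tEE q : (q \in tE) = [&& lat 0 (of_blocks2 q.1), lat 0 (of_blocks2 q.2)
    & nrm (of_blocks2 q.1) + nrm (of_blocks2 q.2) == M].
  rewrite mem_filter tBE E8E8_codeE !lat_of_blocks2 !nrm_of_blocks2 /blocks4_ok.
  rewrite /blocks4_norm /word /=.
  by do 4!case: (block_ok _) => //=; rewrite ?andbF // andbA.
rewrite (_ : map g _ = map (fun q : blk4 => of_blocks2 q.1) (map G tE)); last first.
  by rewrite -!map_comp; apply: eq_map => q /=; rewrite to_blocks2K.
apply: perm_map; apply: perm_involution => [|q|q]; first exact: filter_uniq.
  rewrite !tEE /= to_blocks2K => /and3P[/gi[-> -> _] -> ->] //.
rewrite tEE => /and3P[/gi[_ _ gg] _ _]; rewrite /G /= to_blocks2K gg of_blocks2K.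
by case: q {gg}.
Qed.

End BlockShell.

Lemma half_sextic (R : realType) (a b c d : int) :
  sextic (a%:~R / 2) (b%:~R / 2) (c%:~R / 2) (d%:~R / 2) =
  (sextic a b c d)%:~R / 64 :> R.
Proof.
rewrite /sextic !(intrD, intrB, intrM, rmorphXn) /=.
by field.
Qed.

Lemma W16_moment6 (R : realType) M (t : seq 'rV[int]_16) :
  uniq t -> (forall y, (y \in t) = lat 0 y && (nrm y == M)) ->
  qmoment (map (@half R 16) t) (o16 0) (o16 0) (o16 0)
  - 15 * qmoment (map (@half R 16) t) (o16 0) (o16 0) (o16 1)
  + 30 * qmoment (map (@half R 16) t) (o16 0) (o16 1) (o16 2) = 0.
Proof.
move=> ut tE.
have tD := half_D_invariant R (lat_shell_D_invariant ut tE).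
suff: \sum_(x <- map (@half R 16) t)
    sextic (x 0 (o16 0)) (x 0 (o16 1)) (x 0 (o16 2)) (x 0 (o16 3)) = 0.
  by rewrite (sum_sextic tD) //; lra.
rewrite big_map; under eq_bigr do rewrite !mxE half_sextic.
rewrite -mulr_suml -(big_morph _ (@intrD R) (erefl : 0%:~R = 0)).
(* This common ambient shell, over all glue words, contains the shells of both D16+ and E8 + E8. *)
have [|t' [ut' t'E]] := @finite_rows 16 (fun y =>
    blocks4_ok (to_blocks4 y) && (blocks4_norm (to_blocks4 y) == M)) M.
  by move=> y /andP[_ /eqP <-]; rewrite -nrm_of_blocks4 to_blocks4K.
pose tB := map to_blocks4 t'.
have utB : uniq tB by rewrite map_inj_uniq //; apply: can_inj to_blocks4K.
have tBE q : (q \in tB) = blocks4_ok q && (blocks4_norm q == M).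
  by rewrite -(of_blocks4K q) mem_map ?t'E //; apply: can_inj to_blocks4K.
have tP : perm_eq (map to_blocks4 t) [seq q <- tB | word q \in D16_code].
  apply: uniq_perm => [||q].
  - by rewrite map_inj_uniq //; apply: can_inj to_blocks4K.
  - exact: filter_uniq.
  rewrite mem_filter tBE -{1}(of_blocks4K q) mem_map; last exact: can_inj to_blocks4K.
  by rewrite tE lat_of_blocks4 nrm_of_blocks4 andbAC andbC.
have -> : \sum_(y <- t) sextic (y 0 (o16 0)) (y 0 (o16 1)) (y 0 (o16 2)) (y 0 (o16 3)) =
    \sum_(q <- tB | word q \in E8E8_code) block_sextic q.1.1.
  rewrite -(D16_E8E8_sextic utB tBE) -[RHS]big_filter -(perm_big _ tP) big_map.
  exact: eq_bigr.
have perm8 := E8E8_perm utB tBE.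
set t8 := [seq of_blocks2 q.1 | q <- tB & word q \in E8E8_code] in perm8.
have t8D : D_invariant t8.
  by split=> [i j|i j ij]; apply: perm8; [exact: xcol_isometry|exact: flip2_isometry].
have t8l : {in t8, forall y, lat 0 y}.
  move=> y /mapP[q]; rewrite mem_filter E8E8_codeE tBE.
  move=> /andP[/andP[/= cl _] /andP[/and4P[ok1 ok2 _ _] _]] ->.
  by rewrite lat_of_blocks2 ok1 ok2.
have t8h := half_hadamard2_perm R t8l (perm8 _ hadamard2_isometry).
(* On E8 + E8 the sextic sum vanishes by the moment relation for E8-invariant multisets. *)
have := sum_sextic (half_D_invariant R t8D) (isT : uniq [:: o8 0; o8 1; o8 2; o8 3]).
rewrite (E8_moment6 (half_D_invariant R t8D) t8h (@hadamard2_real0 R)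
  (@hadamard2_real4 R)).
rewrite mulr0 big_map => <-; under eq_bigr do rewrite !mxE half_sextic.
rewrite -mulr_suml -(big_morph _ (@intrD R) (erefl : 0%:~R = 0)) /t8 big_map big_filter.
by congr (_%:~R / _); apply: eq_bigr => -[[[[[a b] c] d] p1] p2] _; rewrite !mxE.
Qed.

(** For s = 1 the conditions are in degrees 2s = 2 and 2s + 4 = 6. *)
Lemma W16_half_design (R : realType) (m : R) : nonempty (shell (@W_lattice R 16) m) ->
  half_design 1 (shell (@W_lattice R 16) m).
Proof.
move=> ne; split=> [j j2|].
  have -> : j = 1%N by lia.
  exact: (shell_cond_C2 _ (fun x : 'rV[R]_16 => W_latticeE x isT)).
have [M [t [ut tE en]]] := shell_enum (fun x : 'rV[R]_16 => W_latticeE x isT) ne.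
exists (map (@half R 16) t); split=> // P.
apply: (@harmonic6_sum0 _ _ _ _ (o16 0) (o16 1) (o16 2)) => //.
  exact/half_D_invariant/(lat_shell_D_invariant ut tE).
exact: (W16_moment6 R ut tE).
Qed.

Unset Implicit Arguments.

Theorem theorem10p2 (R : realType) :
  (* (i) *)
  (forall n : nat, (4 %| n)%N -> (8 <= n)%N ->
     forall m : R,
       (nonempty (shell (@W_lattice R n) m) -> design 3 (shell (@W_lattice R n) m)) /\
       (nonempty (shell (@W_shadow R n) m) -> design 3 (shell (@W_shadow R n) m))) /\
  (* (ii) *)
  (forall m : R, nonempty (shell (@W_lattice R 8) m) ->
     design 7 (shell (@W_lattice R 8) m)) /\
  (* (iii) 3 1/2 = 2*1+1+1/2 *)
  (forall m : R, nonempty (shell (@W_lattice R 16) m) ->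
     half_design 1 (shell (@W_lattice R 16) m)).
Proof.
split=> [n n4 n8 m|].
  have n0 : (0 < n)%N by apply: leq_trans n8.
  have n2 : (2 < n)%N by apply: leq_trans n8.
  have j1 j : (2 <= 2 * j <= 3)%N -> j = 1%N by lia.
  split=> ne j /j1 ->.
    exact: (shell_cond_C2 n2 (fun x : 'rV[R]_n => W_latticeE x n0)).
  exact: (shell_cond_C2 n2 (fun x : 'rV[R]_n => W_shadowE x n0)).
by split=> m; [exact: W8_design7|exact: W16_half_design].
Qed.
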